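(* Let $Q\subset\mathbb{R}^n$ be a compact convex set with nonempty interior, centrally symmetric about the origin, and let $f$ be a convex differentiable function with Lipschitz continuous gradient on $Q$ with constant $L_Q>0$ with respect to the norm $\|\cdot\|_Q$, i.e. $f(y)\le f(x)+\langle\nabla f(x),y-x\rangle+\frac12 L_Q\|y-x\|_Q^2$ for all $x,y\in Q$. Suppose that the space $(\mathbb{R}^n,\|\cdot\|_Q^* )$ is $\Delta_Q$-regular, and let $\varepsilon>0$. Then the smooth minimization algorithm described in the context, run with the norm $\|\cdot\|=\|\cdot\|_Q$, $L=L_Q$, and the prox function $d$ given by the regularity of $(\mathbb{R}^n,\|\cdot\|_Q^* )$ (as described in the context), produces an $\varepsilon$-solution of the problem $\min_{x\in Q}f(x)$ in at most $$\sqrt{\frac{4L_Q\Delta_Q}{\varepsilon}}$$ iterations; that is, there is an integer $t$ with $0\le t\le\sqrt{4L_Q\Delta_Q/\varepsilon}$ such that $f(y_t)-\min_{x\in Q}f(x)\le\varepsilon$. Moreover, the constants $L_Q$ and $\Delta_Q$ are affine invariant: for every nonsingular $A\in\mathbb{R}^{n\times n}$, with $\hat f(w)=f(Aw)$ and $\hat Q=A^{-1}Q$, the function $f$ has Lipschitz continuous gradient on $Q$ with respect to $\|\cdot\|_Q$ with constant $L_Q$ if and only if $\hat f$ has Lipschitz continuous gradient on $\hat Q$ with respect to $\|\cdot\|_{\hat Q}$ with the same constant, and $(\mathbb{R}^n,\|\cdot\|_Q^* )$ is $\Delta_Q$-regular if and only if $(\mathbb{R}^n,\|\cdot\|_{\hat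 Q}^* )$ is $\Delta_Q$-regular.
   Context: Minkowski gauge norm: for a compact convex set $Q$ with nonempty interior, centrally symmetric about $0$, $\|x\|_Q=\inf\{\lambda\ge0: x\in\lambda Q\}$, which is a norm; $\|\cdot\|_Q^*$ is its dual norm. Having Lipschitz continuous gradient on $Q$ with constant $L$ with respect to a norm $\|\cdot\|$ means: $f(y)\le f(x)+\langle\nabla f(x),y-x\rangle+\frac12L\|y-x\|^2$ for all $x,y\in Q$. Regularity: a finite-dimensional normed space $(\mathbb{E},\|\cdot\|)$ is $\Delta$-regular if there exist $\mu$ with $1\le\mu\le\Delta$ and a smooth norm $\pi$ on $\mathbb{E}$ such that (1) $\pi(x)^2/2$ has a Lipschitz continuous gradient with constant $\mu$ with respect to the norm $\pi$, and (2) $\|x\|^2\le\pi(x)^2\le\frac{\Delta}{\mu}\|x\|^2$ for all $x\in\mathbb{E}$. The regularity constant is the smallest such $\Delta$. Prox function used: if $\pi$ is the norm in the definition of $\Delta_Q$-regularity of $(\mathbb{R}^n,\|\cdot\|_Q^* )$, let $p$ be the dual norm of $\pi$; the prox function is $d(x)=p(x)^2/2$, which is used with strong convexity parameter $\sigma=1/\Delta_Q$ with respect to $\|\cdot\|_Q$. Smooth minimization algorithm (Nesterov), for a norm $\|\cdot\|$, a constant $L$ and a prox function $d$ strongly convex on $Q$ with parameter $\sigma$: let $x_0=\arg\min_{x\in Q}d(x)$ (with $d(x_0)=0$), $\alpha_t=(t+1)/2$, $A_t=\sum_{i=0}^t\alpha_i$, $\tau_t=\alpha_{t+1}/A_{t+1}$.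 For $t=0,1,2,\ldots$, compute $$y_t\in\arg\min_{y\in Q}\left\{\langle\nabla f(x_t),y-x_t\rangle+\tfrac12L\|y-x_t\|^2\right\},$$ $$z_t=\arg\min_{x\in Q}\left\{\tfrac{L}{\sigma}d(x)+\sum_{i=0}^t\alpha_i\left[f(x_i)+\langle\nabla f(x_i),x-x_i\rangle\right]\right\},$$ and set $x_{t+1}=\tau_tz_t+(1-\tau_t)y_t$. *)

(* Defs.v *)
From HB Require Import structures.
From mathcomp Require Import all_boot all_order all_algebra.
From mathcomp Require Import all_classical all_reals all_analysis.
Set Implicit Arguments.
Unset Strict Implicit.
Unset Printing Implicit Defensive.
Import Order.TTheory GRing.Theory Num.Theory.
Import numFieldNormedType.Exports.
Local Open Scope classical_set_scope.
Local Open Scope ring_scope.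

Section Norms.
Variables (R : realType) (n : nat).
Local Notation E := 'cV[R]_n.
Implicit Types (N pi : E -> R) (Q : set E) (f : E -> R).

Definition dot (u v : E) : R := \sum_i u i 0 * v i 0.

Definition is_norm N : Prop :=
  [/\ forall x, N x = 0 -> x = 0,
      forall (a : R) x, N (a *: x) = `|a| * N x &
      forall x y, N (x + y) <= N x + N y].

Definition gauge_norm Q (x : E) : R :=
  inf [set lambda : R | 0 <= lambda /\ exists2 q, Q q & x = lambda *: q].

Definition dual_norm N (s : E) : R := sup [set dot s x | x in [set x | N x <= 1]].

Definition grad f (x : E) : E := \col_i 'D_(delta_mx i 0) f x.

Definition has_lipschitz_gradient N (f : E -> R) (L : R) Q : Prop :=
  (forall x, Q x -> differentiable f x) /\
  (forall x y, Q x -> Q y ->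
    f y <= f x + dot (grad f x) (y - x) + L / 2 * N (y - x) ^+ 2).

(* No norm on a nonzero space is differentiable at the origin, so smoothness
   is required away from it. *)
Definition smooth_norm pi : Prop :=
  is_norm pi /\ forall x, x != 0 -> differentiable pi x.

Definition regular_with N (Delta mu : R) pi : Prop :=
  [/\ 1 <= mu <= Delta,
      smooth_norm pi,
      has_lipschitz_gradient pi (fun x => pi x ^+ 2 / 2) mu setT &
      forall x, N x ^+ 2 <= pi x ^+ 2 <= Delta / mu * N x ^+ 2].

Definition regular N (Delta : R) : Prop :=
  exists mu pi, regular_with N Delta mu pi.

Definition prox_function pi (x : E) : R := dual_norm pi x ^+ 2 / 2.

End Norms.

Section SmoothMinimization.
Variables (R : realType) (n : nat).
Local Notation E := 'cV[R]_n.

Definition is_argmin (Q : set E) (phi : E -> R) (x : E) : Prop :=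
  Q x /\ forall y, Q y -> phi x <= phi y.

Definition alpha (t : nat) : R := t.+1%:R / 2.
Definition sum_alpha (t : nat) : R := \sum_(i < t.+1) alpha i.
Definition tau (t : nat) : R := alpha t.+1 / sum_alpha t.+1.

(* The iterates are a relation rather than a function because the minimizer
   defining [y t] need not be unique. *)
Record smooth_minimization_run (N : E -> R) (L : R) (d : E -> R) (sigma : R)
    (Q : set E) (f : E -> R) (x y z : nat -> E) : Prop := {
  run_x0 : is_argmin Q d (x 0%N);
  run_d0 : d (x 0%N) = 0;
  run_y : forall t, is_argmin Q
    (fun u => dot (grad f (x t)) (u - x t) + L / 2 * N (u - x t) ^+ 2) (y t);
  run_z : forall t, is_argmin Q
    (fun u => L / sigma * d u
      + \sum_(i < t.+1) alpha i * (f (x i) + dot (grad f (x i)) (u - x i)))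
    (z t);
  run_x : forall t, x t.+1 = tau t *: z t + (1 - tau t) *: y t
}.

End SmoothMinimization.

(* Main.v *)
Require Import Defs.
From HB Require Import structures.
From mathcomp Require Import all_boot all_order all_algebra.
From mathcomp Require Import all_classical all_reals all_analysis.
From mathcomp Require Import ring lra.
Set Implicit Arguments.
Unset Strict Implicit.
Unset Printing Implicit Defensive.
Import Order.TTheory GRing.Theory Num.Theory.
Import numFieldNormedType.Exports.
Local Open Scope classical_set_scope.
Local Open Scope ring_scope.

(** The algorithm builds a sequence of models of [f]: the estimate
    [L / sigma * d u + sum_i alpha_i * (f x_i + <grad f x_i, u - x_i>)]. By
    convexity its value at a minimizer [u] of [f] is at most
    [L / sigma * d u + sum_alpha t * f u]. Conversely the minimum of the
    estimate stays above [sum_alpha t * f (y t)]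
    ([sum_alpha_f_le_estimate]): the strong convexity of [d] makes the estimate
    grow quadratically around its minimizer, and this growth absorbs the
    quadratic term of the smoothness bound on [f]. Comparing the two gives
    [f (y t) - f u <= 4 * L * d u / (sigma * (t + 1) * (t + 2))]
    ([smooth_minimization_rate]).

    What is specific to the gauge norm is that [d = p ^ 2 / 2], with [p] the
    dual of the norm [pi] that witnesses regularity, is [1 / Delta]-strongly
    convex for it and at most [1 / 2] on [Q]. The functions [pi ^ 2 / 2] and
    [p ^ 2 / 2] are convex conjugates of each other, and conjugation turns a
    Lipschitz gradient of constant [mu] into strong convexity of parameter
    [1 / mu] ([prox_subgradient], [prox_strongly_convex]). Duality also reverses
    the comparison of norms: [pi ^ 2 <= Delta / mu * N^* ^ 2] becomes
    [N ^ 2 <= Delta / mu * p ^ 2] ([norm_le_dual]), so that the two constants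
    multiply to [1 / Delta]; this uses that [N] is the dual of its dual
    ([norm_attained]), that is, the separation of a point from a convex body.
    The other half of the comparison, [N^* <= pi], bounds [p] by [1] on the
    unit ball of the gauge, which is [Q] itself ([gauge_le1]). With [d u <= 1 / 2]
    and [sigma = 1 / Delta], the first integer [t] such that
    [(t + 1) ^ 2 > 4 * L * Delta / eps] makes the error less than [eps].

    Affine invariance is transport of structure: the gauge of the preimage of
    [Q] by [A] is the gauge of [Q] composed with [A], its dual norm is the dual
    norm composed with the inverse transpose of [A], and both the smoothness
    inequality and regularity are stable under composition with an invertible
    linear map. *)

(** * Inner product *)

Section Dot.
Variables (R : realType) (n : nat).
Implicit Types (u v w : 'cV[R]_n).

Lemma dotC u v : dot u v = dot v u.
Proof. by apply: eq_bigr => i _; rewrite mulrC. Qed.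

Lemma dotDr u v w : dot u (v + w) = dot u v + dot u w.
Proof. by rewrite -big_split; apply: eq_bigr => i _; rewrite mxE mulrDr. Qed.

Lemma dotZr a u v : dot u (a *: v) = a * dot u v.
Proof. by rewrite big_distrr; apply: eq_bigr => i _; rewrite mxE mulrCA. Qed.

Lemma dotNr u v : dot u (- v) = - dot u v.
Proof. by rewrite -scaleN1r dotZr mulN1r. Qed.

Lemma dotBr u v w : dot u (v - w) = dot u v - dot u w.
Proof. by rewrite dotDr dotNr. Qed.

Lemma dotDl u v w : dot (v + w) u = dot v u + dot w u.
Proof. by rewrite ![dot _ u]dotC dotDr. Qed.

Lemma dotZl a u v : dot (a *: v) u = a * dot v u.
Proof. by rewrite ![dot _ u]dotC dotZr. Qed.

Lemma dotBl u v w : dot (v - w) u = dot v u - dot w u.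
Proof. by rewrite ![dot _ u]dotC dotBr. Qed.

Lemma dot0r u : dot u 0 = 0.
Proof. by rewrite -(scale0r 0) dotZr mul0r. Qed.

Lemma dot0l u : dot 0 u = 0.
Proof. by rewrite dotC dot0r. Qed.

Lemma dot_gt0 u : u != 0 -> 0 < dot u u.
Proof.
move=> u0; have sq_ge0 i : true -> 0 <= u i 0 * u i 0.
  by rewrite -expr2 sqr_ge0.
rewrite lt0r sumr_ge0 ?andbT//; apply: contra u0 => /eqP /psumr_eq0P u0.
apply/eqP/colP => i; rewrite mxE; apply/eqP.
by rewrite -sqrf_eq0 expr2 u0.
Qed.

Lemma dot_mulmxl (A : 'M[R]_n) u v : dot (A *m u) v = dot u (A^T *m v).
Proof.
rewrite /dot; under eq_bigr do rewrite mxE mulr_suml.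
under [RHS]eq_bigr do rewrite mxE mulr_sumr.
rewrite exchange_big; apply: eq_bigr => i _; apply: eq_bigr => j _ /=.
by rewrite mxE; ring.
Qed.

End Dot.

(** * Norms on a finite-dimensional space *)

(** The common form of first-order optimality arguments below: an inequality
    between a linear and a quadratic term in [t], divided by [t]. *)
Lemma le0_first_order (R : realFieldType) (a c : R) :
  (forall t, 0 < t <= 1 -> a <= t * c) -> a <= 0.
Proof.
move=> ac; rewrite leNgt; apply/negP => a0.
have c0 : 0 < c by have := ac 1; rewrite ltr01 lexx mul1r => /(_ isT); lra.
have ac0 : 0 < a + c by rewrite addr_gt0.
(* at this [t] the bound [t * c] falls below [a] *)
have := ac (a / (a + c)); rewrite divr_gt0//= ler_pdivrMr// mul1r.
rewrite lerDl (ltW c0) mulrAC ler_pdivlMr// => /(_ isT); nra.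
Qed.

Section LinearContinuity.
Variables (R : realType) (m n : nat) (V : normedModType R).

Lemma ler_coord_norm (x : 'M[R]_(m, n)) i j : `|x i j| <= `|x|.
Proof. by rewrite [leRHS]/Num.norm /= mx_normrE; exact: (le_bigmax _ _ (i, j)). Qed.

Lemma linear_mx_continuous (g : {linear 'M[R]_(m, n) -> V}) : continuous g.
Proof.
apply: bounded_linear_continuous.
pose C := \sum_i \sum_j `|g (delta_mx i j)|.
have C_ge0 : 0 <= C by do 2!apply: sumr_ge0 => ? _.
exists C; split=> [|M CM]; [exact: ger0_real|near=> x].
have x1 : `|x| <= 1.
  by near: x; exact: (@nbhs0_le _ 'M[R]_(m, n) 1 ltr01).
apply: le_trans (ltW CM).
rewrite /= [x]matrix_sum_delta linear_sum; apply: le_trans (ler_norm_sum _ _ _) _.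
apply: ler_sum => i _; rewrite linear_sum; apply: le_trans (ler_norm_sum _ _ _) _.
apply: ler_sum => j _; rewrite linearZ normrZ ler_piMl//.
exact: le_trans (ler_coord_norm _ _ _) x1.
Unshelve. all: by end_near. Qed.

End LinearContinuity.

Section Norms.
Variables (R : realType) (n : nat).
Local Notation E := 'cV[R]_n.
Implicit Types (N : E -> R) (x y s : E).

(** The Heine-Borel theorem for row vectors, carried over by transposition. *)
Lemma bounded_closed_compact_col (A : set E) :
  bounded_set A -> closed A -> compact A.
Proof.
move=> [M [Mr AM]] Acl.
rewrite (_ : A = [set trmx x | x in (trmx @^-1` A : set 'rV[R]_n)]); last first.
  apply/seteqP; split=> [x Ax|_ [x Ax <-]//].
  by exists x^T; rewrite /= trmxK.
apply: continuous_compact.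
  exact/continuous_subspaceT/(@linear_mx_continuous R 1 n E trmx).
apply: bounded_closed_compact.
  exists M; split=> // r Mr' x /= Ax; apply: le_trans (AM _ Mr' _ Ax).
  rewrite [leLHS]/Num.norm /= mx_normrE; apply/bigmax_leP; split=> // -[i j] _ /=.
  by have := ler_coord_norm x^T j i; rewrite mxE.
apply: preimage_closed => // x _.
exact: (@linear_mx_continuous R 1 n E trmx).
Qed.

Lemma norm_0 N : is_norm N -> N 0 = 0.
Proof. by case=> _ NZ _; rewrite -(scale0r 0) NZ normr0 mul0r. Qed.

Lemma norm_opp N x : is_norm N -> N (- x) = N x.
Proof. by case=> _ NZ _; rewrite -scaleN1r NZ normrN1 mul1r. Qed.

Lemma norm_nneg N x : is_norm N -> 0 <= N x.
Proof.
move=> Nn; have [_ _ ND] := Nn; have := ND x (- x).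
by rewrite subrr norm_0// norm_opp// -mulr2n pmulrn_lge0.
Qed.

Lemma norm_pos N x : is_norm N -> x != 0 -> 0 < N x.
Proof.
move=> Nn x0; rewrite lt0r norm_nneg// andbT.
by have [N0 _ _] := Nn; apply: contra x0 => /eqP/N0/eqP.
Qed.

Lemma norm_sum N (I : Type) (r : seq I) (F : I -> E) : is_norm N ->
  N (\sum_(i <- r) F i) <= \sum_(i <- r) N (F i).
Proof.
move=> Nn; have [_ _ ND] := Nn.
elim/big_ind2 : _ => [|x1 y1 x2 y2 h1 h2|//]; first by rewrite norm_0.
by apply: le_trans (ND _ _) _; rewrite lerD.
Qed.

Lemma norm_le_sup_norm N : is_norm N ->
  exists2 C, 0 < C & forall x, N x <= C * `|x|.
Proof.
move=> Nn; have [_ NZ _] := Nn.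
exists (1 + \sum_i N (delta_mx i 0)).
  by rewrite ltr_pwDl ?ltr01// sumr_ge0// => i _; exact: norm_nneg.
move=> x; rewrite {1}[x]matrix_sum_delta; apply: le_trans (norm_sum _ _ Nn) _.
rewrite mulrDl mulr_suml ler_wpDl ?mul1r//.
apply: ler_sum => i _; rewrite big_ord1 NZ mulrC ler_wpM2l ?norm_nneg//.
exact: ler_coord_norm.
Qed.

(** In finite dimension [N] is bounded by a multiple of the sup norm, hence
    Lipschitz for it. *)
Lemma is_norm_continuous N : is_norm N -> continuous N.
Proof.
move=> Nn x; have [_ _ ND] := Nn; have [C C0 NC] := norm_le_sup_norm Nn.
apply/(@cvgrPdist_le _ _ _ _ (nbhs_filter x)) => e e0; near=> y.
have xy : `|x - y| <= e / C.
  near: y.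
  exact: (@cvgr_dist_le R E E _ (nbhs_filter x) id x _ _ (divr_gt0 e0 C0)).
have {}xy : N (x - y) <= e.
  by apply: le_trans (NC _) _; rewrite mulrC -ler_pdivlMr.
rewrite ler_norml; apply/andP; split.
  have := ND (y - x) x; rewrite subrK -opprB norm_opp//; lra.
by have := ND (x - y) y; rewrite subrK; lra.
Unshelve. all: by end_near. Qed.

(** Equivalence of norms: the unit sphere of the sup norm is compact, so [N]
    is bounded away from zero on it. *)
Lemma sup_norm_le_norm N : is_norm N ->
  exists2 c, 0 < c & forall x, c * `|x| <= N x.
Proof.
move=> Nn; have [_ NZ _] := Nn.
pose S : set E := [set x | `|x| = 1].
have [[x0 Sx0]|S0] := pselect (S !=set0); last first.
  exists 1 => // x; have [->|x0] := eqVneq x 0.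
    by rewrite normr0 mulr0 norm_nneg.
  exfalso; apply: S0; exists (`|x|^-1 *: x).
  by rewrite /S /= normrZ normfV normr_id mulVf// normr_eq0.
have Scompact : compact S.
  apply: bounded_closed_compact_col.
    by exists 1; split=> // r r1 x /= ->; exact: ltW.
  rewrite (_ : S = (fun x : E => `|x|) @^-1` [set 1])//.
  apply: preimage_closed; last exact: closed_eq.
  by move=> x _; exact: norm_continuous.
have [|c cS cmin] := @compact_EVT_min _ _ N _ (ex_intro _ x0 Sx0) Scompact.
  exact/continuous_subspaceT/is_norm_continuous.
have {cS}c1 : `|c| = 1 by rewrite inE in cS.
exists (N c).
  by apply: norm_pos => //; rewrite -normr_eq0 c1 oner_eq0.
move=> x; have [->|x0'] := eqVneq x 0; first by rewrite normr0 mulr0 norm_nneg.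
have xpos : 0 < `|x| by rewrite normr_gt0.
have : N c <= N (`|x|^-1 *: x).
  by apply: cmin; rewrite inE /S /= normrZ normfV normr_id mulVf// gt_eqF.
by rewrite NZ normfV normr_id mulrC ler_pdivlMr.
Qed.

Lemma unit_ball_compact N : is_norm N -> compact [set x | N x <= 1].
Proof.
move=> Nn; apply: bounded_closed_compact_col.
  have [c c0 cN] := sup_norm_le_norm Nn.
  exists c^-1; split; first by rewrite realV gtr0_real.
  move=> r cr x /= x1; apply: le_trans (ltW cr).
  by rewrite -[c^-1]mul1r ler_pdivlMr// mulrC (le_trans (cN x)).
rewrite (_ : mkset _ = N @^-1` [set r | r <= 1])//.
apply: preimage_closed; last exact: closed_le.
by move=> x _; exact: is_norm_continuous.
Qed.

(** * Dual norms *)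

Lemma dot_continuous s : continuous (dot s).
Proof.
have dot_linear : linear (dot s) by move=> a u v; rewrite dotDr dotZr.
pose g := GRing.isLinear.Build R E R *%R (dot s) dot_linear.
pose G : {linear E -> R} := HB.pack (dot s) g.
exact: (@linear_mx_continuous R n 1 R G).
Qed.

(** The unit ball is compact, so the supremum that defines the dual norm is a
    maximum. *)
Lemma dual_norm_max N s : is_norm N ->
  exists x, [/\ N x <= 1, dot s x = dual_norm N s &
    forall y, N y <= 1 -> dot s y <= dual_norm N s].
Proof.
move=> Nn.
have B0 : [set x | N x <= 1] !=set0 by exists 0; rewrite /= norm_0// ler01.
have [|x xB xmax] :=
    @compact_EVT_max _ _ (dot s) _ B0 (unit_ball_compact Nn).
  exact/continuous_subspaceT/dot_continuous.
rewrite inE /= in xB.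
have {}xmax y : N y <= 1 -> dot s y <= dot s x by move=> ?; apply: xmax; rewrite inE.
suff -> : dual_norm N s = dot s x by exists x.
have xub : ubound [set dot s x | x in [set x | N x <= 1]] (dot s x).
  by move=> _ [y yB <-]; exact: xmax.
apply/eqP; rewrite eq_le ge_sup//=; last by exists (dot s x); exists x.
by apply: ub_le_sup; [exists (dot s x) | exists x].
Qed.

Lemma dual_norm_attained N s : is_norm N ->
  exists2 x, N x <= 1 & dot s x = dual_norm N s.
Proof. by move=> /dual_norm_max -/(_ s)[x [? ? _]]; exists x. Qed.

Lemma dual_norm_ub N s x : is_norm N -> N x <= 1 -> dot s x <= dual_norm N s.
Proof. by move=> /dual_norm_max -/(_ s)[_ [_ _]]; exact. Qed.

Lemma dual_norm_le N s r : is_norm N ->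
  (forall x, N x <= 1 -> dot s x <= r) -> dual_norm N s <= r.
Proof. by move=> /dual_norm_attained -/(_ s)[x x1 <-]; exact. Qed.

Lemma dot_le_dual_norm N s x : is_norm N -> dot s x <= dual_norm N s * N x.
Proof.
move=> Nn; have [_ NZ _] := Nn.
have [->|x0] := eqVneq x 0; first by rewrite dot0r norm_0// mulr0.
have Nx := norm_pos Nn x0.
rewrite -ler_pdivrMr// mulrC -dotZr; apply: dual_norm_ub => //.
by rewrite NZ gtr0_norm ?invr_gt0// mulVf// gt_eqF.
Qed.

Lemma dual_norm_ge0 N s : is_norm N -> 0 <= dual_norm N s.
Proof.
move=> Nn; apply: le_trans (dual_norm_ub s Nn (x := 0) _).
  by rewrite dot0r.
by rewrite norm_0// ler01.
Qed.

Lemma dual_norm_is_norm N : is_norm N -> is_norm (dual_norm N).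
Proof.
move=> Nn; have [_ NZ _] := Nn.
have dualZ_le a s : dual_norm N (a *: s) <= `|a| * dual_norm N s.
  apply: dual_norm_le => // x x1; rewrite dotZl -dotZr.
  apply: le_trans (dot_le_dual_norm _ _ Nn) _; rewrite NZ mulrCA.
  by rewrite mulrA ler_piMr// mulr_ge0// dual_norm_ge0.
split=> [s s0|a s|s t].
- apply/eqP; apply: contraT => s_neq0.
  have := dot_le_dual_norm s s Nn.
  by rewrite s0 mul0r leNgt dot_gt0.
- apply/eqP; rewrite eq_le dualZ_le/=.
  have [->|a0] := eqVneq a 0.
    by rewrite normr0 mul0r dual_norm_ge0.
  rewrite mulrC -ler_pdivlMr ?normr_gt0// mulrC -normfV.
  by apply: le_trans (dualZ_le _ _); rewrite scalerA mulVf// scale1r.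
- apply: dual_norm_le => // x x1; rewrite dotDl.
  by rewrite lerD// dual_norm_ub.
Qed.

(** Separation of [x] from the unit ball of [N] by the hyperplane through the
    Euclidean projection of [x] onto that ball. *)
Lemma separate_unit_ball N x : is_norm N -> 1 < N x ->
  exists2 s, dual_norm N s <= 1 & 1 < dot s x.
Proof.
move=> Nn Nx; have [_ NZ ND] := Nn.
pose sqdist (q : E) : R := dot (x - q) (x - q).
have B0 : [set x | N x <= 1] !=set0 by exists 0; rewrite /= norm_0// ler01.
have [|q qB qmin] :=
    @compact_EVT_min _ _ sqdist _ B0 (unit_ball_compact Nn).
  have coordB i : continuous (fun v : E => (x - v) i 0).
    have -> : (fun v : E => (x - v) i 0) = (fun v => x i 0 - v i 0).
      by apply/funext => v; rewrite !mxE.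
    move=> u; apply: (@cvgB _ _ _ _ (nbhs_filter u)).
      exact: (@cvg_cst _ _ _ _ (nbhs_filter u)).
    exact: coord_continuous.
  apply: continuous_subspaceT; apply: continuous_big => [|i _ u].
    by move=> p; apply: cvgD; [exact: cvg_fst|exact: cvg_snd].
  by apply: (@cvgM _ _ _ (nbhs_filter u)); exact: coordB.
rewrite inE /= in qB.
have {}qmin y : N y <= 1 -> sqdist q <= sqdist y.
  by move=> ?; apply: qmin; rewrite inE.
have [s sE] : exists s, s = x - q by exists (x - q).
have s0 : s != 0.
  apply: contraTneq Nx; rewrite sE => /eqP; rewrite subr_eq0 => /eqP ->.
  by rewrite -leNgt.
have ss : 0 < dot s s := dot_gt0 s0.
have sq y : N y <= 1 -> dot s y <= dot s q.
  move=> y1; have [v vE] : exists v, v = y - q by exists (y - q).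
  rewrite -subr_le0 -dotBr -vE leNgt; apply/negP => sv.
  (* moving from q towards y decreases the distance to x to first order *)
  have step t : 0 <= t <= 1 -> 2 * t * dot s v <= t ^+ 2 * dot v v.
    move=> /andP[t0 t1]; have := qmin (q + t *: v).
    have -> : sqdist (q + t *: v) = dot s s - 2 * t * dot s v + t ^+ 2 * dot v v.
      rewrite /sqdist opprD addrA -sE dotBl !dotBr !dotZl !dotZr [dot v s]dotC.
      ring.
    rewrite {1}/sqdist -sE.
    suff : N (q + t *: v) <= 1 by move=> /[swap] /[apply]; lra.
    have -> : q + t *: v = (1 - t) *: q + t *: y.
      by rewrite vE scalerBr scalerBl scale1r addrA addrAC.
    apply: le_trans (ND _ _) _; rewrite !NZ !ger0_norm//; last by lra.
    by nra.
  have : dot s v <= 0.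
    apply: (@le0_first_order _ _ (dot v v / 2)) => t /andP[t0 t1].
    rewrite -(ler_pM2l (mulr_gt0 (ltr0n _ 2) t0)).
    by have := step t; rewrite t1 ltW//= => /(_ isT); nra.
  by rewrite leNgt sv.
have dq : dual_norm N s <= dot s q by apply: dual_norm_le.
have dpos : 0 < dual_norm N s by apply: norm_pos => //; exact: dual_norm_is_norm.
exists ((dual_norm N s)^-1 *: s).
  have [_ -> _] := dual_norm_is_norm Nn.
  by rewrite gtr0_norm ?invr_gt0// mulVf// gt_eqF.
rewrite dotZl mulrC ltr_pdivlMr// mul1r (le_lt_trans dq)//.
by rewrite -subr_gt0 -dotBr -sE.
Qed.

(** [N] is the dual of its dual: were the double dual of [x] smaller than
    [N x], then [x] divided by it would lie outside the unit ball, and the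
    hyperplane separating them would contradict the definition of the double
    dual. *)
Lemma norm_attained N x : is_norm N ->
  exists2 s, dual_norm N s <= 1 & N x <= dot s x.
Proof.
move=> Nn; have [_ NZ _] := Nn.
have dn := dual_norm_is_norm Nn.
have [s s1 sx] := dual_norm_attained x dn.
exists s => //; rewrite dotC sx leNgt; apply/negP => lt_x.
have ddn := dual_norm_is_norm dn.
have x0 : x != 0.
  by apply: contraTneq lt_x => ->; rewrite !norm_0// ltxx.
have ddx : 0 < dual_norm (dual_norm N) x by exact: norm_pos.
pose k := (dual_norm (dual_norm N) x)^-1.
have k0 : 0 < k by rewrite invr_gt0.
have [|t t1] := @separate_unit_ball N (k *: x) Nn.
  by rewrite NZ gtr0_norm// mulrC ltr_pdivlMr// mul1r.
rewrite dotZr mulrC ltr_pdivlMr// mul1r dotC ltNge => /negP; apply.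
exact: dual_norm_ub.
Qed.

End Norms.

(** * Gauge norms *)

Section ConvexCombination.
Variables (R : realType) (n : nat) (Q : set 'cV[R]_n).

Lemma convex_setP : convex_set Q ->
  forall t x y, 0 <= t <= 1 -> Q x -> Q y -> Q (t *: x + (1 - t) *: y).
Proof.
move=> Qc t x y /andP[t0 t1] Qx Qy.
have := Qc x y (Itv01 t0 t1); rewrite !inE; exact.
Qed.

Lemma convex_functionP (f : 'cV[R]_n -> R) : convex_function Q f ->
  forall t x y, 0 <= t <= 1 -> Q x -> Q y ->
    f (t *: x + (1 - t) *: y) <= t * f x + (1 - t) * f y.
Proof.
move=> fc t x y /andP[t0 t1] Qx Qy.
by have := fc (Itv01 t0 t1) x y; rewrite !inE; exact.
Qed.

End ConvexCombination.

Section Gauge.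
Variables (R : realType) (n : nat) (Q : set 'cV[R]_n).
Hypotheses (Q_compact : compact Q) (Q_convex : convex_set Q).
Hypotheses (Q_interior : interior Q !=set0) (Q_symmetric : forall x, Q x -> Q (- x)).
Local Notation E := 'cV[R]_n.
Implicit Types (x y q : E).

Local Notation gauge := (gauge_norm Q).

(** Averaging a ball inside [Q] with its opposite centres it at the origin. *)
Lemma ball_sub_symmetric_convex :
  exists2 r, 0 < r & forall x, `|x| < r -> Q x.
Proof.
have [c cQ] := Q_interior.
have /nbhs_ballP[r /= r0 rQ] : nbhs c Q := cQ.
exists r => // x xr.
have Qp : Q (c + x).
  by apply: rQ; rewrite -ball_normE /= opprD addrA subrr sub0r normrN.
have Qm : Q (- (c - x)).
  apply: Q_symmetric; apply: rQ; rewrite -ball_normE /=.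
  by rewrite opprB addrCA subrr addr0.
have := convex_setP Q_convex (t := 2^-1) _ Qp Qm.
have -> : 2^-1 *: (c + x) + (1 - 2^-1) *: - (c - x) = x.
  by apply/matrixP => i j; rewrite !mxE; lra.
by apply; apply/andP; split; lra.
Qed.

Lemma zero_in : Q 0.
Proof. by have [r r0] := ball_sub_symmetric_convex; apply; rewrite normr0. Qed.

Let dilations x := [set l : R | 0 <= l /\ exists2 q, Q q & x = l *: q].

Let dilations_nonempty x : dilations x !=set0.
Proof.
have [r r0 rQ] := ball_sub_symmetric_convex.
have p : 0 < (`|x| + 1) / r by rewrite divr_gt0// ltr_wpDl.
exists ((`|x| + 1) / r); split; first exact: ltW.
exists (((`|x| + 1) / r)^-1 *: x); last by rewrite scalerA mulfV ?scale1r// gt_eqF.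
apply: rQ; rewrite normrZ gtr0_norm ?invr_gt0// mulrC ltr_pdivrMr//.
by rewrite mulrC divfK ?gt_eqF// ltrDl.
Qed.

Lemma gauge_ge0 x : 0 <= gauge x.
Proof. by apply: (lb_le_inf (dilations_nonempty x)) => l []. Qed.

Lemma gauge_scale_le l q : 0 <= l -> Q q -> gauge (l *: q) <= l.
Proof. by move=> l0 Qq; apply: ge_inf; [exists 0 => k []|split=> //; exists q]. Qed.

(** The infimum that defines the gauge may a priori not be attained, but any
    larger dilation factor will do, since [Q] is star-shaped around the
    origin. *)
Lemma gauge_lt_in x l : gauge x < l -> Q (l^-1 *: x).
Proof.
move=> xl; have l0 : 0 < l := le_lt_trans (gauge_ge0 x) xl.
have [k [k0 [q Qq ->]] kl] := inf_lt (dilations_nonempty x) xl.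
have := convex_setP Q_convex (t := k / l) _ Qq zero_in.
rewrite scaler0 addr0 scalerA [l^-1 * k]mulrC; apply.
by rewrite divr_ge0 ?(ltW l0)//= ler_pdivrMr// mul1r ltW.
Qed.

(** The direct implication is where closedness of [Q] enters: [x / l] belongs to
    [Q] for all [l > 1]. *)
Lemma gauge_le1 x : gauge x <= 1 <-> Q x.
Proof.
split=> [x1|Qx]; last by rewrite -[x]scale1r gauge_scale_le.
apply: contrapT => nQx.
have /nbhs_ballP[e /= e0 eQ] : nbhs x (~` Q).
  apply: open_nbhs_nbhs; split=> //; apply: closed_openC.
  by apply: compact_closed => //; exact: norm_hausdorff.
(* close enough to 1 for [x / l] to lie in the ball of radius [e] around [x] *)
pose l := 1 + e / (`|x| + 1).
have x10 : 0 < `|x| + 1 by rewrite ltr_wpDl.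
have l1 : 1 < l by rewrite ltrDl divr_gt0.
have l0 : 0 < l by apply: lt_trans l1.
apply: (eQ (l^-1 *: x)); last exact/gauge_lt_in/(le_lt_trans x1).
rewrite -ball_normE /= -[x in x - _]scale1r -scalerBl normrZ.
rewrite ger0_norm; last by rewrite subr_ge0 invf_le1// ltW.
have -> : 1 - l^-1 = l^-1 * (e / (`|x| + 1)).
  rewrite -[X in X - _](mulVf (x := l)) ?gt_eqF//.
  rewrite -[X in _ - X]mulr1 -mulrBr; congr (_ * _).
  by rewrite /l addrAC subrr add0r.
have lt_e : e / (`|x| + 1) * `|x| < e.
  by rewrite mulrAC ltr_pdivrMr// ltr_pM2l// ltrDl.
apply: le_lt_trans lt_e; rewrite -[leLHS]mulrA ler_piMl ?invf_le1 ?(ltW l1)//.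
by rewrite mulr_ge0// divr_ge0// ltW.
Qed.

Let gauge_le_lt x r : (forall l, gauge x < l -> r <= l) -> r <= gauge x.
Proof. by move=> h; apply/ler_addgt0Pr => e e0; apply: h; rewrite ltrDl. Qed.

Lemma gauge_is_norm : is_norm gauge.
Proof.
have scale_inv x l : gauge x < l -> x = l *: (l^-1 *: x).
  move=> xl; rewrite scalerA mulfV ?scale1r// gt_eqF//.
  exact: le_lt_trans (gauge_ge0 x) xl.
have gaugeZ_le a x : gauge (a *: x) <= `|a| * gauge x.
  have [->|a0] := eqVneq a 0.
    rewrite scale0r normr0 mul0r -[X in gauge X](scale0r 0).
    by apply: gauge_scale_le => //; exact: zero_in.
  rewrite -ler_pdivrMl ?normr_gt0//; apply: gauge_le_lt => l xl.
  have l0 : 0 <= l := le_trans (gauge_ge0 x) (ltW xl).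
  rewrite ler_pdivrMl ?normr_gt0// (scale_inv _ _ xl) scalerA.
  have Qx := gauge_lt_in xl.
  have [a1|a1] := leP 0 a.
    by rewrite (ger0_norm a1) gauge_scale_le// mulr_ge0.
  rewrite ltr0_norm// -[a * l]opprK scaleNr -scalerN -mulNr.
  apply: gauge_scale_le; last exact: Q_symmetric.
  by rewrite mulr_ge0// oppr_ge0 ltW.
split=> [x x0|a x|x y].
- apply/eqP; rewrite -normr_le0.
  have [M [Mr QM]] := compact_bounded Q_compact.
  have {QM} : forall q, Q q -> `|q| <= `|M| + 1.
    by apply: QM; rewrite (le_lt_trans (ler_norm M))// ltrDl.
  move=> QM; apply/ler_addgt0Pr => e e0; rewrite add0r.
  have M0 : 0 < `|M| + 1 by rewrite ltr_wpDl.
  have xl : gauge x < e / (`|M| + 1) by rewrite x0 divr_gt0.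
  rewrite (scale_inv _ _ xl) normrZ ger0_norm; last by rewrite divr_ge0// ltW.
  by rewrite mulrAC ler_pdivrMr// ler_pM2l// QM//; exact: gauge_lt_in.
- apply/eqP; rewrite eq_le gaugeZ_le/=.
  have [->|a0] := eqVneq a 0; first by rewrite normr0 mul0r gauge_ge0.
  rewrite -ler_pdivlMl ?normr_gt0// -normfV.
  by apply: le_trans (gaugeZ_le _ _); rewrite scalerA mulVf// scale1r.
- rewrite -lerBlDr; apply: gauge_le_lt => l xl.
  rewrite lerBlDr -lerBlDl; apply: gauge_le_lt => k yk; rewrite lerBlDl.
  have l0 := le_lt_trans (gauge_ge0 x) xl.
  have k0 := le_lt_trans (gauge_ge0 y) yk.
  have lk0 : 0 < l + k by rewrite addr_gt0.
  rewrite (scale_inv _ _ xl) (scale_inv _ _ yk).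
  have -> : l *: (l^-1 *: x) + k *: (k^-1 *: y) =
     (l + k) *: (l / (l + k) *: (l^-1 *: x) + (1 - l / (l + k)) *: (k^-1 *: y)).
    rewrite scalerDr !(scalerA (l + k)) mulrBr mulr1 mulrC divfK ?gt_eqF//.
    by rewrite [l + k - _]addrC addKr.
  apply: gauge_scale_le; first exact: ltW.
  apply: convex_setP; [exact: Q_convex| |exact: gauge_lt_in|exact: gauge_lt_in].
  by rewrite divr_ge0 ?ler_pdivrMr ?mul1r ?lerDl ?ltW.
Qed.

End Gauge.

(** * Strong convexity of the prox function *)

Section StrongConvexity.
Variables (R : realType) (n : nat).
Local Notation E := 'cV[R]_n.
Implicit Types (N pi d : E -> R) (Q : set E) (x y u v w : E).

(** Stated along segments, because a prox function, being the square of a dual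
    norm, need not be differentiable. *)
Definition strongly_convex N (sigma : R) Q d := forall u v (t : R),
  Q u -> Q v -> 0 <= t <= 1 ->
  d (t *: u + (1 - t) *: v) + sigma / 2 * (t * (1 - t)) * N (u - v) ^+ 2
    <= t * d u + (1 - t) * d v.

(** The Fenchel-Young inequality between [pi ^ 2 / 2] and its conjugate. *)
Lemma dot_le_prox pi v xi : is_norm pi ->
  dot v xi <= prox_function pi v + pi xi ^+ 2 / 2.
Proof.
move=> pin; have := dot_le_dual_norm v xi pin.
rewrite /prox_function; have := sqr_ge0 (dual_norm pi v - pi xi); nra.
Qed.

(** Let [xi] maximize [<w, xi> - pi xi ^ 2 / 2]. By optimality [w] is the
    gradient of [pi ^ 2 / 2] at [xi]. Inserting the smoothness bound at
    [xi + eta] into the Fenchel-Young inequality for [v] gives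
    [d v >= d w + <v - w, xi> + <v - w, eta> - mu / 2 * pi eta ^ 2], and the
    supremum over [eta] of the last two terms is [p (v - w) ^ 2 / (2 * mu)]. *)
Lemma prox_subgradient pi mu w : is_norm pi -> 0 < mu ->
  has_lipschitz_gradient pi (fun x => pi x ^+ 2 / 2) mu setT ->
  exists xi, forall v,
    prox_function pi w + dot xi (v - w) + mu^-1 / 2 * dual_norm pi (v - w) ^+ 2
      <= prox_function pi v.
Proof.
move=> pin mu0 [_ lip]; have [_ piZ _] := pin.
have [x x1 wx] := dual_norm_attained w pin.
pose xi := dual_norm pi w *: x.
have wxi : prox_function pi w + pi xi ^+ 2 / 2 <= dot w xi.
  have p0 := dual_norm_ge0 w pin; have pix := norm_nneg x pin.
  have pix2 : pi x ^+ 2 <= 1 by rewrite expr_le1.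
  have : dual_norm pi w ^+ 2 * pi x ^+ 2 <= dual_norm pi w ^+ 2.
    by rewrite ler_piMr// sqr_ge0.
  by rewrite /prox_function dotZr wx piZ ger0_norm// exprMn -expr2; lra.
clearbody xi.
have [g {}lip] : exists g, forall eta, pi (xi + eta) ^+ 2 / 2
    <= pi xi ^+ 2 / 2 + dot g eta + mu / 2 * pi eta ^+ 2.
  exists (grad (fun x => pi x ^+ 2 / 2) xi) => eta.
  by have := lip xi (xi + eta) I I; rewrite [xi + eta - _]addrAC subrr add0r.
have wg : w = g.
  apply/eqP; rewrite -subr_eq0; apply: contraT => /dot_gt0; rewrite ltNge => /negP[].
  apply: (@le0_first_order _ _ (mu / 2 * pi (w - g) ^+ 2)) => t /andP[t0 _].
  have := lip (t *: (w - g)).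
  have := dot_le_prox w (xi + t *: (w - g)) pin.
  rewrite piZ (gtr0_norm t0) dotDr !dotZr dotBl => *.
  by rewrite -(ler_pM2l t0); nra.
exists xi => v.
(* the optimal [eta] is [p / mu] times the vector [y] that attains [p] *)
have [y y1 vy] := dual_norm_attained (v - w) pin.
set p := dual_norm pi (v - w) in vy *.
have p0 : 0 <= p by exact: dual_norm_ge0.
have := lip ((p / mu) *: y); have := dot_le_prox v (xi + (p / mu) *: y) pin.
rewrite piZ ger0_norm ?divr_ge0 ?(ltW mu0)// -wg [dot v (xi + _)]dotDr !dotZr.
have -> : dot v y = dot w y + p by rewrite -vy dotBl addrC subrK.
rewrite [dot xi _]dotC dotBl.
have piy : pi y ^+ 2 <= 1.
  by rewrite expr_le1// norm_nneg.
have : mu / 2 * (p / mu * pi y) ^+ 2 <= mu^-1 / 2 * p ^+ 2.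
  rewrite [leLHS](_ : _ = mu^-1 / 2 * p ^+ 2 * pi y ^+ 2); last by field; lra.
  by rewrite ler_piMr// mulr_ge0 ?sqr_ge0// divr_ge0// invr_ge0 ltW.
have : p / mu * (dot w y + p) = p / mu * dot w y + 2 * (mu^-1 / 2 * p ^+ 2).
  by field; lra.
lra.
Qed.

Lemma prox_strongly_convex pi mu : is_norm pi -> 0 < mu ->
  has_lipschitz_gradient pi (fun x => pi x ^+ 2 / 2) mu setT ->
  strongly_convex (dual_norm pi) mu^-1 setT (prox_function pi).
Proof.
move=> pin mu0 lip u v t _ _ /andP[t0 t1].
set w := t *: u + (1 - t) *: v.
have [xi xiw] := prox_subgradient w pin mu0 lip.
have [_ pZ _] := dual_norm_is_norm pin.
have uw : u - w = (1 - t) *: (u - v).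
  by rewrite /w; apply/matrixP => i j; rewrite !mxE; ring.
have vw : v - w = (- t) *: (u - v).
  by rewrite /w; apply/matrixP => i j; rewrite !mxE; ring.
have := xiw u; have := xiw v; rewrite uw vw !pZ normrN !ger0_norm ?subr_ge0//.
rewrite !dotZr; set p := dual_norm _ _; set c := dot _ _.
set m := mu^-1.
move=> hv hu.
have t1' : 0 <= 1 - t by lra.
have := ler_wpM2l t0 hu; have := ler_wpM2l t1' hv.
nra.
Qed.

(** Dualization reverses the comparison of two norms. *)
Lemma norm_le_dual N pi (c : R) x : is_norm N -> is_norm pi ->
  (forall s, pi s ^+ 2 <= c * dual_norm N s ^+ 2) -> 0 <= c ->
  N x ^+ 2 <= c * dual_norm pi x ^+ 2.
Proof.
move=> Nn pin pic c0.
have [s s1 xs] := norm_attained x Nn.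
have : N x <= dual_norm pi x * pi s.
  by apply: le_trans xs _; rewrite dotC dot_le_dual_norm.
have N0 := norm_nneg x Nn.
have dx := dual_norm_ge0 x pin.
have pis : pi s ^+ 2 <= c.
  apply: le_trans (pic s) _; rewrite ler_piMr//.
  by rewrite expr_le1// dual_norm_ge0.
move=> Nle; apply: le_trans (_ : (dual_norm pi x * pi s) ^+ 2 <= _).
  by rewrite lerXn2r ?nnegrE// mulr_ge0// norm_nneg.
by rewrite exprMn mulrC ler_wpM2r// sqr_ge0.
Qed.

Section Regular.
Variables (N pi : E -> R) (Delta mu : R).
Hypotheses (N_norm : is_norm N) (reg : regular_with (dual_norm N) Delta mu pi).

Lemma regular_prox_strongly_convex Q :
  strongly_convex N (1 / Delta) Q (prox_function pi).
Proof.
have [/andP[mu1 muD] [pin _] lip cmp] := reg.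
have mu0 : 0 < mu by lra.
have D0 : 0 < Delta by lra.
move=> u v t _ _ t01.
apply: le_trans (prox_strongly_convex pin mu0 lip (u := u) (v := v) I I t01).
have /andP[t0 t1] := t01.
have tt : 0 <= t * (1 - t) by rewrite mulr_ge0// subr_ge0.
rewrite lerD2l.
have Nle : N (u - v) ^+ 2 <= Delta / mu * dual_norm pi (u - v) ^+ 2.
  apply: norm_le_dual => //; last by rewrite divr_ge0// ltW.
  by move=> s; have /andP[] := cmp s.
have := ler_wpM2l (mulr_ge0 (ltW (_ : 0 < 1 / Delta / 2)) tt) Nle.
move=> /(_ (divr_gt0 (divr_gt0 ltr01 D0) (ltr0n _ 2)))/le_trans; apply.
by rewrite le_eqVlt; apply/orP; left; apply/eqP; field; apply/andP; split; lra.
Qed.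

Lemma regular_prox_le x : N x <= 1 -> prox_function pi x <= 1 / 2.
Proof.
have [_ [pin _] _ cmp] := reg.
move=> x1; rewrite /prox_function ler_pM2r ?invr_gt0// expr_le1 ?dual_norm_ge0//.
apply: dual_norm_le => // s s1; rewrite dotC.
apply: le_trans (dot_le_dual_norm _ _ N_norm) _.
have d0 := dual_norm_ge0 s N_norm.
have s1' : dual_norm N s <= 1.
  rewrite -(@expr_le1 _ 2)//; have /andP[/le_trans + _] := cmp s; apply.
  by rewrite expr_le1// norm_nneg.
by rewrite mulr_ile1// norm_nneg.
Qed.

End Regular.
End StrongConvexity.

(** * First-order convexity *)

Section Gradient.
Variables (R : realType) (n : nat).
Local Notation E := 'cV[R]_n.
Implicit Types (f : E -> R) (x y v : E) (Q : set E).

Lemma dot_grad f x v : differentiable f x -> dot (grad f x) v = 'd f x v.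
Proof.
move=> fx; rewrite [in RHS](matrix_sum_delta v) linear_sum; apply: eq_bigr => i _.
by rewrite big_ord1 linearZ mxE deriveE// mulrC.
Qed.

(** The slope of [f] along the segment from [x] to [y] is at most [f y - f x],
    and it tends to the directional derivative. *)
Lemma convex_grad_le f Q x y : convex_function Q f -> differentiable f x ->
  Q x -> Q y -> f x + dot (grad f x) (y - x) <= f y.
Proof.
move=> fc fx Qx Qy.
rewrite dot_grad// -deriveE// addrC -lerBrDr.
have /cvg_dnbhs_at_right fD := diff_derivable (v := y - x) fx.
apply: (cvgr_to_le fD); near=> h.
have h0 : 0 < h by [].
have h1 : h <= 1 by near: h; exact: nbhs_right_le.
rewrite /= ler_pdivrMl//.
have := convex_functionP fc (t := h) (x := y) (y := x) _ Qy Qx.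
have -> : h *: y + (1 - h) *: x = h *: (y - x) + x.
  by apply/matrixP => i j; rewrite !mxE; ring.
rewrite (ltW h0) h1 => /(_ isT); lra.
Unshelve. all: by end_near. Qed.

End Gradient.

(** * The estimate sequence *)

Section Weights.
Variable R : realType.

Lemma alpha_gt0 t : 0 < alpha R t.
Proof. by rewrite divr_gt0. Qed.

Lemma sum_alphaE t : sum_alpha R t = t.+1%:R * t.+2%:R / 4.
Proof.
elim: t => [|t IH]; first by rewrite /sum_alpha big_ord1 /alpha /=; lra.
rewrite /sum_alpha big_ord_recr -/(sum_alpha R t) IH /alpha /=.
by rewrite -[t.+3]addn3 -[t.+2]addn2 -[t.+1]addn1 !natrD; field.
Qed.

Lemma sum_alphaS t : sum_alpha R t.+1 = sum_alpha R t + alpha R t.+1.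
Proof. by rewrite /sum_alpha big_ord_recr. Qed.

Lemma sum_alpha_gt0 t : 0 < sum_alpha R t.
Proof. by rewrite sum_alphaE divr_gt0// mulr_gt0. Qed.

Lemma tau_itv t : 0 < tau R t <= 1.
Proof.
rewrite /tau divr_gt0 ?alpha_gt0 ?sum_alpha_gt0//= ler_pdivrMr ?sum_alpha_gt0//.
by rewrite mul1r sum_alphaS lerDr ltW// sum_alpha_gt0.
Qed.

Lemma sum_alpha_tau t : sum_alpha R t.+1 * tau R t = alpha R t.+1.
Proof. by rewrite /tau mulrC divfK// gt_eqF// sum_alpha_gt0. Qed.

(** Equivalently [alpha t.+1 ^ 2 <= sum_alpha t.+1]: this is the constraint
    that the induction puts on the growth of the weights, and it allows
    [sum_alpha] to be quadratic in [t]. *)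
Lemma sum_alpha_tau2_le1 t : sum_alpha R t.+1 * tau R t ^+ 2 <= 1.
Proof.
rewrite expr2 mulrA sum_alpha_tau /tau mulrA ler_pdivrMr ?sum_alpha_gt0//.
rewrite mul1r sum_alphaE /alpha.
have : 0 < t.+2%:R :> R by [].
by rewrite -[t.+3]addn1 natrD; nra.
Qed.

End Weights.

Section StrongMinimum.
Variables (R : realType) (n : nat).
Local Notation E := 'cV[R]_n.
Variables (N : E -> R) (Q : set E).

(** Compare [z] with points of the segment towards [x] that tend to [z]. *)
Lemma strongly_convex_argmin (s : R) (phi : E -> R) (z x : E) : convex_set Q ->
  strongly_convex N s Q phi -> is_argmin Q phi z -> Q x ->
  phi z + s / 2 * N (x - z) ^+ 2 <= phi x.
Proof.
move=> Qc sc [Qz zmin] Qx; rewrite -subr_le0.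
apply: (@le0_first_order _ _ (s / 2 * N (x - z) ^+ 2)) => t /andP[t0 t1].
have t01 : 0 <= t <= 1 by rewrite ltW.
have := zmin _ (convex_setP Qc t01 Qx Qz); have := sc x z t Qx Qz t01.
by move=> *; rewrite -(ler_pM2l t0); lra.
Qed.

Lemma strongly_convexD_affine (c s : R) (d h : E -> R) : 0 <= c ->
  (forall u v t, h (t *: u + (1 - t) *: v) = t * h u + (1 - t) * h v) ->
  strongly_convex N s Q d -> strongly_convex N (c * s) Q (fun u => c * d u + h u).
Proof.
move=> c0 haff sc u v t Qu Qv t01; rewrite haff.
by have := ler_wpM2l c0 (sc u v t Qu Qv t01); lra.
Qed.

End StrongMinimum.

Section Convergence.
Variables (R : realType) (n : nat).
Local Notation E := 'cV[R]_n.
Variables (N d f : E -> R) (L sigma : R) (Q : set E) (x y z : nat -> E).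
Hypotheses (N_norm : is_norm N) (L_gt0 : 0 < L) (sigma_gt0 : 0 < sigma).
Hypotheses (Q_convex : convex_set Q) (f_convex : convex_function Q f).
Hypothesis f_lipschitz : has_lipschitz_gradient N f L Q.
Hypothesis d_convex : strongly_convex N sigma Q d.
Hypothesis run : smooth_minimization_run N L d sigma Q f x y z.

Let linearization i u := f (x i) + dot (grad f (x i)) (u - x i).

Let estimate t u :=
  L / sigma * d u + \sum_(i < t.+1) alpha R i * linearization i u.

Let run_in t : [/\ Q (x t), Q (y t) & Q (z t)].
Proof.
have [[Qx0 _] _ ymin zmin xS] := run.
have Qy s : Q (y s) by case: (ymin s).
have Qz s : Q (z s) by case: (zmin s).
split=> //; case: t => // t; rewrite xS.
by apply: convex_setP => //; have /andP[/ltW-> ->] := tau_itv R t.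
Qed.

Let estimate_min t u : Q u ->
  estimate t (z t) + L / 2 * N (u - z t) ^+ 2 <= estimate t u.
Proof.
move=> Qu; have -> : L = L / sigma * sigma by rewrite divfK// gt_eqF.
apply: strongly_convex_argmin (run_z run t) Qu => //.
apply: strongly_convexD_affine => //; first by rewrite divr_ge0 ?ltW.
move=> v w r; rewrite !mulr_sumr -big_split; apply: eq_bigr => i _ /=.
rewrite !dotBr dotDr !dotZr; ring.
Qed.

Let y_decrease t u : Q u ->
  f (y t) <= linearization t u + L / 2 * N (u - x t) ^+ 2.
Proof.
move=> Qu; have [Qx Qy _] := run_in t; have [_ ymin] := run_y run t.
have [_ lip] := f_lipschitz.
by have := lip _ _ Qx Qy; have := ymin u Qu; rewrite /linearization; lra.
Qed.

(** Nesterov's invariant. The step [z t.+1 - z t], shrunk by [tau t], is a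
    feasible displacement from [x t.+1]; the quadratic growth of the estimate
    around its minimizer pays for the quadratic term of the smoothness bound. *)
Lemma sum_alpha_f_le_estimate t :
  sum_alpha R t * f (y t) <= estimate t (z t).
Proof.
elim: t => [|t IH].
  have [Qx0 _ Qz0] := run_in 0.
  rewrite /estimate /sum_alpha !big_ord1.
  have a0 : alpha R 0 = 2^-1 by rewrite /alpha mul1r.
  rewrite a0.
  have dz : sigma / 2 * N (z 0 - x 0) ^+ 2 <= d (z 0).
    have := strongly_convex_argmin Q_convex d_convex (run_x0 run) Qz0.
    by rewrite (run_d0 run) add0r.
  have := y_decrease 0 Qz0.
  have : L / 2 * N (z 0 - x 0) ^+ 2 <= L / sigma * d (z 0).
    apply: le_trans (ler_wpM2l (_ : 0 <= L / sigma) dz); last first.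
      by rewrite divr_ge0 ?ltW.
    by rewrite le_eqVlt; apply/orP; left; apply/eqP; field; rewrite gt_eqF.
  have : 0 <= L / 2 * N (z 0 - x 0) ^+ 2.
    by rewrite mulr_ge0 ?sqr_ge0// divr_ge0// ltW.
  by rewrite /= ; lra.
have [Qx Qy Qz] := run_in t; have [Qx' Qy' Qz'] := run_in t.+1.
set A := sum_alpha R t in IH *; set A' := sum_alpha R t.+1; set a := alpha R t.+1.
have A0 : 0 < A := sum_alpha_gt0 R t.
have A'E : A' = A + a := sum_alphaS R t.
have estS : estimate t.+1 (z t.+1) =
    estimate t (z t.+1) + a * linearization t.+1 (z t.+1).
  by rewrite /estimate big_ord_recr /= addrA.
have grow := estimate_min t Qz'.
have [fdiff _] := f_lipschitz.
have fy : linearization t.+1 (y t) <= f (y t).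
  by apply: convex_grad_le f_convex _ _ _ => //; exact: fdiff.
(* the feasible point at which the minimality of [y t.+1] is used *)
pose u := tau R t *: z t.+1 + (1 - tau R t) *: y t.
have Qu : Q u by apply: convex_setP => //; have /andP[/ltW-> ->] := tau_itv R t.
have ux : u - x t.+1 = tau R t *: (z t.+1 - z t).
  by rewrite (run_x run) /u; apply/matrixP => i j; rewrite !mxE; ring.
have A'tau : A' * tau R t = a := sum_alpha_tau R t.
have A'tau2 : A' * tau R t ^+ 2 <= 1 := sum_alpha_tau2_le1 R t.
have lin_u : A' * linearization t.+1 u =
    a * linearization t.+1 (z t.+1) + A * linearization t.+1 (y t).
  have AE : A = A' * (1 - tau R t) by rewrite mulrBr mulr1 A'tau A'E addrK.
  rewrite -A'tau AE /linearization /u !dotBr dotDr !dotZr; ring.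
have := y_decrease t.+1 Qu; rewrite ux.
have [_ NZ _] := N_norm; rewrite NZ exprMn real_normK ?num_real// => dec.
have A'0 : 0 < A' := sum_alpha_gt0 R t.+1.
have {}dec := ler_wpM2l (ltW A'0) dec.
have quad : A' * (L / 2 * (tau R t ^+ 2 * N (z t.+1 - z t) ^+ 2)) <=
    L / 2 * N (z t.+1 - z t) ^+ 2.
  have -> : A' * (L / 2 * (tau R t ^+ 2 * N (z t.+1 - z t) ^+ 2)) =
      A' * tau R t ^+ 2 * (L / 2 * N (z t.+1 - z t) ^+ 2) by ring.
  by rewrite ler_piMl// mulr_ge0 ?sqr_ge0// divr_ge0// ltW.
rewrite estS; have := ler_wpM2l (ltW A0) fy; lra.
Qed.

Lemma smooth_minimization_rate t u : Q u ->
  f (y t) - f u <= 4 * L * d u / (sigma * (t.+1%:R * t.+2%:R)).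
Proof.
move=> Qu; have [_ _ Qz] := run_in t.
have [fdiff _] := f_lipschitz.
have lin_le : \sum_(i < t.+1) alpha R i * linearization i u <= sum_alpha R t * f u.
  rewrite mulr_suml; apply: ler_sum => i _.
  have [Qx _ _] := run_in i; apply: ler_wpM2l; first exact/ltW/alpha_gt0.
  by apply: convex_grad_le f_convex _ _ _ => //; exact: fdiff.
have := sum_alpha_f_le_estimate t; have [_ /(_ u Qu)] := run_z run t.
rewrite -/(estimate t (z t)) -/(estimate t u) => zu yz.
have {zu} := le_trans yz zu; rewrite /estimate.
have A0 := sum_alpha_gt0 R t.
move=> h; rewrite -(ler_pM2l A0).
rewrite [leRHS](_ : _ = L / sigma * d u); first by lra.
by rewrite sum_alphaE; field; rewrite !gt_eqF.
Qed.

End Convergence.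

(** * Existence of a run *)

Section Existence.
Variables (R : realType) (n : nat).
Local Notation E := 'cV[R]_n.
Variables (N d f : E -> R) (L sigma : R) (Q : set E).
Hypotheses (N_norm : is_norm N) (Q_compact : compact Q) (Q0 : Q 0).
Hypotheses (d_continuous : continuous d) (d_ge0 : forall x, 0 <= d x) (d0 : d 0 = 0).

Lemma argmin_exists (phi : E -> R) : (forall x, Q x -> {for x, continuous phi}) ->
  exists x, is_argmin Q phi x.
Proof.
move=> phic.
have [|c cQ cmin] := @compact_EVT_min _ _ phi _ (ex_intro _ 0 Q0) Q_compact.
  by apply: continuous_in_subspaceT => x; rewrite inE; exact: phic.
rewrite inE in cQ; exists c; split=> // y Qy; apply: cmin.
by rewrite inE.
Qed.

Let argmin (phi : E -> R) : E := xget 0 (is_argmin Q phi).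

Let argminP phi : continuous phi -> is_argmin Q phi (argmin phi).
Proof. by move=> phic; apply: xgetPex; apply: argmin_exists => x _; exact: phic. Qed.

Let linearization x u := f x + dot (grad f x) (u - x).

Let y_objective x u := dot (grad f x) (u - x) + L / 2 * N (u - x) ^+ 2.

Let z_objective (acc : E -> R) u := L / sigma * d u + acc u.

(** The minimization that defines [z t] involves all the earlier points, so the
    state of the algorithm is the current point together with the weighted sum
    of the linearizations accumulated before it. *)
Fixpoint algorithm_state (t : nat) : E * (E -> R) :=
  if t isn't t'.+1 then (0, fun=> 0) else
  let: (x, acc) := algorithm_state t' in
  let acc' := fun u => acc u + alpha R t' * linearization x u in
  (tau R t' *: argmin (z_objective acc')
    + (1 - tau R t') *: argmin (y_objective x), acc').

Let x t := (algorithm_state t).1.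

Let algorithm_stateE t u :
  (algorithm_state t).2 u = \sum_(i < t) alpha R i * linearization (x i) u.
Proof.
elim: t => [|t IH]; first by rewrite big_ord0.
rewrite big_ord_recr /= -IH /x /=.
by case: (algorithm_state t).
Qed.

Let y_objective_continuous a : continuous (y_objective a).
Proof.
move=> u; have FF := nbhs_filter u.
have sub_cont : (v - a) @[v --> u] --> u - a.
  by apply: (@cvgB _ _ _ _ FF); [exact: cvg_id|exact: (@cvg_cst _ _ _ _ FF)].
apply: (@cvgD _ _ _ _ FF).
  by apply: cvg_comp sub_cont _; exact: dot_continuous.
apply: (@cvgM _ _ _ FF); first exact: (@cvg_cst _ _ _ _ FF).
have Nc : N (v - a) @[v --> u] --> N (u - a).
  by apply: cvg_comp sub_cont _; exact: is_norm_continuous.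
by rewrite expr2; apply: (@cvgM _ _ _ FF).
Qed.

Let z_objective_continuous (I : Type) (r : seq I) (c : I -> R) (a : I -> E) :
  continuous (z_objective (fun u => \sum_(i <- r) c i * linearization (a i) u)).
Proof.
pose g := \sum_(i <- r) c i *: grad f (a i).
pose b := \sum_(i <- r) c i * (f (a i) - dot (grad f (a i)) (a i)).
have -> : z_objective (fun u => \sum_(i <- r) c i * linearization (a i) u) =
    (fun u => L / sigma * d u + (b + dot g u)).
  apply/funext => u; rewrite /z_objective; congr (_ + _).
  rewrite /b /g {b g}; elim: r => [|i r IH]; first by rewrite !big_nil dot0l addr0.
  rewrite !big_cons IH dotDl dotZl /linearization dotBr; ring.
move=> u; have FF := nbhs_filter u.
apply: (@cvgD _ _ _ _ FF).
  by apply: (@cvgM _ _ _ FF); [exact: (@cvg_cst _ _ _ _ FF)|exact: d_continuous].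
apply: (@cvgD _ _ _ _ FF); first exact: (@cvg_cst _ _ _ _ FF).
exact: dot_continuous.
Qed.

Lemma smooth_minimization_run_exists :
  exists x y z, smooth_minimization_run N L d sigma Q f x y z.
Proof.
exists x, (fun t => argmin (y_objective (x t))),
  (fun t => argmin (z_objective (algorithm_state t.+1).2)).
split=> [|//|t|t|t].
- by split=> // u _; rewrite d0.
- exact/argminP/y_objective_continuous.
- have -> : (algorithm_state t.+1).2 =
      (fun u => \sum_(i < t.+1) alpha R i * linearization (x i) u).
    by apply/funext => u; exact: algorithm_stateE.
  exact/argminP/z_objective_continuous.
- by rewrite /x /=; case: (algorithm_state t).
Qed.

End Existence.

(** * Change of variables *)

Section ChangeOfVariables.
Variables (R : realType) (n : nat).
Local Notation E := 'cV[R]_n.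
Implicit Types (N f : E -> R) (Q : set E) (A B : 'M[R]_n).

Let mulmx_continuous A : continuous (mulmx A : E -> E).
Proof. exact: (@linear_mx_continuous R n 1 E (mulmx A)). Qed.

Let mulmx_differentiable A (w : E) : differentiable (mulmx A : E -> E) w.
Proof. exact/linear_differentiable/mulmx_continuous. Qed.

Lemma differentiable_comp_mulmx A f w : differentiable f (A *m w) ->
  differentiable (fun x => f (A *m x)) w.
Proof. exact: (differentiable_comp (mulmx_differentiable A w)). Qed.

(** The chain rule. *)
Lemma dot_grad_comp_mulmx A f w v : differentiable f (A *m w) ->
  dot (grad (fun x => f (A *m x)) w) v = dot (grad f (A *m w)) (A *m v).
Proof.
move=> fd; rewrite !dot_grad//; last exact: differentiable_comp_mulmx.
rewrite (@diff_comp _ _ _ _ (mulmx A) f)//=.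
by rewrite (@diff_lin _ _ _ (mulmx A))//; exact: mulmx_continuous.
Qed.

Lemma has_lipschitz_gradient_comp_mulmx A N f L Q :
  has_lipschitz_gradient N f L Q ->
  has_lipschitz_gradient (fun w => N (A *m w)) (fun w => f (A *m w)) L
    (mulmx A @^-1` Q).
Proof.
move=> [fd lip]; split=> [w Qw|w v Qw Qv].
  by apply: differentiable_comp_mulmx; exact: fd.
rewrite dot_grad_comp_mulmx; last exact: fd.
by rewrite mulmxBr; exact: lip.
Qed.

Lemma image_invmx A Q : A \in unitmx ->
  [set invmx A *m x | x in Q] = mulmx A @^-1` Q.
Proof.
move=> Au; apply/seteqP; split=> [_ [x Qx <-]|w Qw] /=.
  by rewrite mulKVmx.
by exists (A *m w) => //; rewrite mulKmx.
Qed.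

Lemma gauge_norm_preimage A Q : A \in unitmx ->
  gauge_norm (mulmx A @^-1` Q) = (fun w => gauge_norm Q (A *m w)).
Proof.
move=> Au; apply/funext => w; congr inf; apply/seteqP.
split=> l [l0 [q Qq e]]; split=> //.
  by exists (A *m q) => //; rewrite e scalemxAr.
exists (invmx A *m q); first by rewrite /= mulKVmx.
by rewrite scalemxAr -e mulKmx.
Qed.

Lemma dual_norm_comp_mulmx A N : A \in unitmx ->
  dual_norm (fun w => N (A *m w)) = (fun s => dual_norm N ((invmx A)^T *m s)).
Proof.
move=> Au; apply/funext => s; congr sup; apply/seteqP.
split=> _ [v v1 <-].
  by exists (A *m v) => //; rewrite dot_mulmxl trmxK mulKmx.
exists (invmx A *m v); first by rewrite /= mulKVmx.
by rewrite dot_mulmxl trmxK.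
Qed.

Lemma has_lipschitz_gradient_affine_invariant A f L Q : A \in unitmx ->
  has_lipschitz_gradient (gauge_norm Q) f L Q <->
  has_lipschitz_gradient (gauge_norm [set invmx A *m x | x in Q])
    (fun w => f (A *m w)) L [set invmx A *m x | x in Q].
Proof.
move=> Au; rewrite image_invmx// gauge_norm_preimage//.
split; first exact: has_lipschitz_gradient_comp_mulmx.
move=> /(@has_lipschitz_gradient_comp_mulmx (invmx A)).
rewrite -comp_preimage.
have -> : mulmx A \o mulmx (invmx A) = id :> (E -> E).
  by apply/funext => x /=; rewrite mulKVmx.
have comp_id (g : E -> R) : (fun w => g (A *m (invmx A *m w))) = g.
  by apply/funext => x; rewrite mulKVmx.
by rewrite !comp_id.
Qed.

Lemma regular_comp_mulmx B N Delta : B \in unitmx ->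
  regular N Delta -> regular (fun w => N (B *m w)) Delta.
Proof.
move=> Bu [mu [pi [muD [[pi0 piZ piD] pid] lip cmp]]].
exists mu, (fun w => pi (B *m w)).
have B0 w : B *m w = 0 -> w = 0.
  by move=> Bw; rewrite -[w](mulKmx Bu) Bw mulmx0.
split=> //.
  split; first split=> [w /pi0/B0//|a w|w v].
  - by rewrite -scalemxAr piZ.
  - by rewrite mulmxDr piD.
  move=> w w0; apply: differentiable_comp_mulmx; apply: pid.
  by apply: contra w0 => /eqP/B0/eqP.
exact: (has_lipschitz_gradient_comp_mulmx B lip).
Qed.

Lemma regular_affine_invariant A Q Delta : A \in unitmx ->
  regular (dual_norm (gauge_norm Q)) Delta <->
  regular (dual_norm (gauge_norm [set invmx A *m x | x in Q])) Delta.
Proof.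
move=> Au; rewrite image_invmx// gauge_norm_preimage// dual_norm_comp_mulmx//.
split; first by apply: regular_comp_mulmx; rewrite unitmx_tr unitmx_inv.
move=> /(@regular_comp_mulmx A^T); rewrite unitmx_tr => /(_ Au).
congr (regular _ _); apply/funext => s.
by rewrite mulmxA -trmx_mul mulmxV// trmx1 mul1mx.
Qed.

End ChangeOfVariables.

(** * The iteration bound *)

Theorem proposition3p9 (R : realType) (n : nat) (Q : set 'cV[R]_n)
  (f : 'cV[R]_n -> R)
  (Q_compact : compact Q) (Q_convex : convex_set Q) (Q_interior : interior Q !=set0)
  (Q_symmetric : forall x, Q x -> Q (- x))
  (f_convex : convex_function Q f)
  (f_diff : forall x, Q x -> differentiable f x) :
  (forall (L_Q Delta_Q mu eps : R) (pi : 'cV[R]_n -> R),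
     0 < L_Q ->
     has_lipschitz_gradient (gauge_norm Q) f L_Q Q ->
     regular_with (dual_norm (gauge_norm Q)) Delta_Q mu pi ->
     0 < eps ->
     (exists x y z, smooth_minimization_run (gauge_norm Q) L_Q
        (prox_function pi) (1 / Delta_Q) Q f x y z) /\
     (forall x y z, smooth_minimization_run (gauge_norm Q) L_Q
        (prox_function pi) (1 / Delta_Q) Q f x y z ->
        exists2 t : nat, t%:R <= Num.sqrt (4 * L_Q * Delta_Q / eps) &
          exists2 xmin, is_argmin Q f xmin & f (y t) - f xmin <= eps)) /\
  (forall A : 'M[R]_n, A \in unitmx ->
     let f_hat := fun w : 'cV[R]_n => f (A *m w) in
     let Q_hat := [set invmx A *m x | x in Q] in
     (forall L : R,
        has_lipschitz_gradient (gauge_norm Q) f L Q <->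
        has_lipschitz_gradient (gauge_norm Q_hat) f_hat L Q_hat) /\
     (forall Delta : R,
        regular (dual_norm (gauge_norm Q)) Delta <->
        regular (dual_norm (gauge_norm Q_hat)) Delta)).
Proof.
have G_norm : is_norm (gauge_norm Q) by exact: gauge_is_norm.
have inQ : forall x, gauge_norm Q x <= 1 <-> Q x by exact: gauge_le1.
have Q0 : Q 0 by exact: zero_in.
split; last first.
  move=> A Au; split=> [L|Delta].
    exact: has_lipschitz_gradient_affine_invariant.
  exact: regular_affine_invariant.
move=> L Delta mu eps pi L0 lip reg eps0.
have [/andP[mu1 muD] [pin _] _ _] := reg.
have D0 : 0 < Delta by lra.
have pn := dual_norm_is_norm pin.
split.
  apply: smooth_minimization_run_exists => //.
  - move=> x; have FF := nbhs_filter x.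
    apply: (@cvgM _ _ _ FF); last exact: (@cvg_cst _ _ _ _ FF).
    have pc := is_norm_continuous pn (x := x).
    by rewrite expr2; apply: (@cvgM _ _ _ FF).
  - by move=> x; rewrite divr_ge0// sqr_ge0.
  - by rewrite /prox_function norm_0// expr0n mul0r.
move=> x y z run.
have [|xmin [Qmin minP]] := @argmin_exists _ _ Q Q_compact Q0 f.
  by move=> u Qu; apply: differentiable_continuous; exact: f_diff.
set s := Num.sqrt _; exists (Num.truncn s).
  by have /andP[] := truncn_itv (sqrtr_ge0 (4 * L * Delta / eps)).
exists xmin => //.
set t := Num.truncn s.
have s2 : s ^+ 2 = 4 * L * Delta / eps.
  by rewrite sqr_sqrtr// divr_ge0 ?mulr_ge0// ltW.
have st : s < t.+1%:R := truncnS_gt s.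
have s0 : 0 <= s := sqrtr_ge0 _.
have sigma0 : 0 < 1 / Delta by rewrite divr_gt0.
have := smooth_minimization_rate G_norm L0 sigma0 Q_convex f_convex lip
  (regular_prox_strongly_convex G_norm reg (Q := Q)) run t Qmin.
move=> /le_trans; apply.
have d_le := regular_prox_le G_norm reg ((inQ xmin).2 Qmin).
have t1 : 0 < t.+1%:R :> R by [].
have t2 : 0 < t.+2%:R :> R by [].
rewrite ler_pdivrMr; last exact/(mulr_gt0 sigma0)/mulr_gt0.
have -> : eps * (1 / Delta * (t.+1%:R * t.+2%:R)) =
    eps / Delta * (t.+1%:R * t.+2%:R).
  by ring.
have tt : s ^+ 2 <= t.+1%:R * t.+2%:R.
  rewrite expr2 ler_pM ?(ltW st)//; apply/ltW/(lt_trans st).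
  by rewrite ltr_nat.
have : 4 * L = eps / Delta * s ^+ 2 by rewrite s2; field; rewrite !lt0r_neq0.
have : eps / Delta * s ^+ 2 <= eps / Delta * (t.+1%:R * t.+2%:R).
  by rewrite ler_wpM2l// divr_ge0// ltW.
have : 4 * L * prox_function pi xmin <= 4 * L * (1 / 2).
  by rewrite ler_wpM2l// mulr_ge0// ltW.
lra.
Qed.
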